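(* Let $X,Y$ be real Banach spaces, let $A=(A_{n,k}:n,k\in\omega)$ be a matrix of linear operators in $\mathcal{L}(X,Y)$, and let $\mathcal{J}$ be a strongly selective ideal on $\omega$. Then $A\in(c(X),\ell_\infty(Y,\mathcal{J}))$ if and only if there exists $k_0\in\omega$ such that: (T1$^\flat$) there exists $J_0\in\mathcal{J}^\star$ for which $\sup_{n\in J_0}\|A_{n,\ge k_0}\|<\infty$ and, for all $n\in\omega\setminus J_0$, there exists $f(n)\in\omega$ such that $\|A_{n,\ge f(n)}\|<\infty$; (T2$^\flat$) $\mathcal{J}\text{-}\limsup_n\|A_{n,k}x\|<\infty$ for all $x\in X$ and $k<k_0$; (T4$^\flat$) $\sum_kA_{n,k}$ converges in the strong operator topology for all $n\in\omega$. In addition, if each $A_{n,k}$ is bounded, it is possible to choose $k_0=0$.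
   Context: $\omega$ is the set of nonnegative integers. An ideal on $\omega$ is a family of subsets of $\omega$ closed under subsets and finite unions; every ideal is assumed to contain all finite sets and to differ from the power set of $\omega$. $\mathcal{J}^\star=\{S\subseteq\omega:\omega\setminus S\in\mathcal{J}\}$, $\mathcal{J}^+=\{S\subseteq\omega:S\notin\mathcal{J}\}$. An ideal $\mathcal{J}$ is strongly selective if for every decreasing sequence $(S_n)$ in $\mathcal{J}^+$ there is $S=\{x_n:n\in\omega\}\in\mathcal{J}^+$ (with $(x_n)$ the increasing enumeration of $S$) such that $x_{n+1}\in S_{x_n}$ for all $n\in\omega$. For a nonnegative sequence $(y_n)$, $\mathcal{J}\text{-}\limsup_ny_n=\inf\{r\in\mathbf{R}\cup\{\infty\}:\{n:y_n\ge r\}\in\mathcal{J}\}$. For a Banach space $V$, $c(V)$ is the space of norm-convergent sequences in $V$ and $\ell_\infty(V,\mathcal{J})=\{\boldsymbol{x}\in V^\omega:\mathcal{J}\text{-}\limsup_n\|x_n\|<\infty\}$. $\mathcal{L}(X,Y)$ is the space of all (not necessarily bounded) linear operators $X\to Y$, with the strong operator topology (convergence of $\sum_kA_{n,k}$ means norm convergence of $\sum_kA_{n,k}x$ for every $x\in X$). For $E\subseteq\omega$, the group norm is $\|A_{n,E}\|=\sup\{\|\sum_{k\in F}A_{n,k}x_k\|:F\subseteq E\text{ finite},\ x_k\in X,\ \|x_k\|\le1\}\in[0,\infty]$; $A_{n,\ge k}=A_{n,\{k,k+1,\dots\}}$. $A\boldsymbol{x}=(A_n\boldsymbol{x})_n$,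 $A_n\boldsymbol{x}=\sum_kA_{n,k}x_k$, provided each series converges in norm. $A\in(\mathscr{A},\mathscr{B})$ means that $A\boldsymbol{x}$ is well defined and in $\mathscr{B}$ for every $\boldsymbol{x}\in\mathscr{A}$. *)

(* Defs.v *)
From HB Require Import structures.
From mathcomp Require Import all_boot all_order all_algebra finmap.
From mathcomp Require Import all_classical all_reals all_analysis.

Set Implicit Arguments.
Unset Strict Implicit.
Unset Printing Implicit Defensive.

Import Order.TTheory GRing.Theory Num.Theory.
Import numFieldNormedType.Exports.

Local Open Scope classical_set_scope.
Local Open Scope ring_scope.

Record set_ideal (J : set (set nat)) : Prop := SetIdeal {
  ideal_sub : forall S T : set nat, S `<=` T -> J T -> J S ;
  ideal_setU : forall S T : set nat, J S -> J T -> J (S `|` T) ;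
  ideal_fin : forall S : set nat, finite_set S -> J S ;
  ideal_proper : J <> setT }.

Definition dual_filter (J : set (set nat)) : set (set nat) :=
  [set S | J (~` S)].

Definition positive_sets (J : set (set nat)) : set (set nat) := ~` J.

(* The increasing enumeration of the selector set is a strictly increasing
   function [x], so that the selector set itself is [range x]. *)
Definition strongly_selective (J : set (set nat)) : Prop :=
  forall S : nat -> set nat,
    (forall n, positive_sets J (S n)) ->
    (forall n, S n.+1 `<=` S n) ->
  exists x : nat -> nat,
    [/\ {homo x : m n / (m < n)%N},
        positive_sets J (range x) &
        forall n, S (x n) (x n.+1)].

(* The infimum ranges over thresholds in R together with +oo, excluding -oo. *)
Definition ideal_limsup (R : realType) (J : set (set nat)) (y : nat -> R) :
    \bar R :=
  ereal_inf [set r : \bar R | r != -oo%E /\ J [set n | (r <= (y n)%:E)%E]].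

Definition convergent_seqs (R : realType) (V : completeNormedModType R) :
    set (nat -> V) :=
  [set x | cvgn x].

Arguments convergent_seqs {R} V.

Definition ideal_bounded_seqs (R : realType) (V : completeNormedModType R)
    (J : set (set nat)) : set (nat -> V) :=
  [set x | (ideal_limsup J (fun n => `|x n|%R) < +oo)%E].

Arguments ideal_bounded_seqs {R} V J.

Section OperatorMatrices.
Context (R : realType) (X Y : completeNormedModType R).

(* Linear operators are not assumed to be continuous. *)
Definition operator_matrix := nat -> nat -> {linear X -> Y}.

Definition group_norm (A : operator_matrix) (n : nat) (E : set nat) : \bar R :=
  ereal_sup [set r : \bar R | exists (F : {fset nat}) (x : nat -> X),
    [/\ [set` F] `<=` E,
        forall k, `|x k| <= 1 &
        r = (`|\sum_(k <- F) A n k (x k)|)%:E]].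

Definition tail_norm (A : operator_matrix) (n k : nat) : \bar R :=
  group_norm A n [set j | (k <= j)%N].

Definition row_series (A : operator_matrix) (n : nat) (x : nat -> X) :
    nat -> Y :=
  series (fun k => A n k (x k)).

Definition matrix_apply (A : operator_matrix) (x : nat -> X) : nat -> Y :=
  fun n => limn (row_series A n x).

Definition matrix_class (P : set (nat -> X)) (Q : set (nat -> Y))
    (A : operator_matrix) : Prop :=
  forall x, P x ->
    (forall n, cvgn (row_series A n x)) /\ Q (matrix_apply A x).

Definition tail_condition (A : operator_matrix) (J : set (set nat)) (k0 : nat) :
    Prop :=
  exists J0 : set nat,
    [/\ dual_filter J J0,
        (ereal_sup [set tail_norm A n k0 | n in J0] < +oo)%E &
        forall n, ~ J0 n -> exists fn : nat, (tail_norm A n fn < +oo)%E].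

Definition column_condition (A : operator_matrix) (J : set (set nat))
    (k0 : nat) : Prop :=
  forall (x : X) (k : nat), (k < k0)%N ->
    (ideal_limsup J (fun n => `|A n k x|%R) < +oo)%E.

(* Convergence of the row sums in the strong operator topology. *)
Definition row_convergence (A : operator_matrix) : Prop :=
  forall (n : nat) (x : X), cvgn (row_series A n (fun=> x)).

End OperatorMatrices.

(* Main.v *)
Require Import Defs.
From HB Require Import structures.
From mathcomp Require Import all_boot all_order all_algebra finmap.
From mathcomp Require Import all_classical all_reals all_analysis.
From mathcomp Require Import lra.
Set Implicit Arguments.
Unset Strict Implicit.
Unset Printing Implicit Defensive.

Import Order.TTheory GRing.Theory Num.Theory.
Import numFieldNormedType.Exports.
Local Open Scope classical_set_scope.
Local Open Scope ring_scope.

(** Sufficiency is a direct estimate. A convergent sequence is a constant one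
plus a null one; strong convergence of the row sums deals with the constant, and
a finite tail norm makes the row series of the null sequence Cauchy. For rows in
[J0] the part of the sum beyond [k0] is at most the tail norm times the supremum
of the sequence, and the finitely many columns before [k0] are bounded modulo
[J] ([matrix_class_of_conditions]).

For necessity, constant sequences and sequences with a single nonzero term give
the row and column conditions. The uniform bound on tail norms is a gliding hump
argument ([matrix_class_tail_ideal]). If it fails, then for every [a] the rows
whose tail norm beyond [a] exceeds [3a(a+1)] form a positive set. For such a row
[n] there is a finitely supported sequence [u(a,n)] beyond [a], of size at most
[1/(a+1)], whose image in row [n] is larger than [3a]. There are only countably
many of these sequences and, the matrix being in the class, the image of each is
bounded by some [r(a,n)] outside a set of the ideal. A sufficiently fast growing
function [G] can therefore be fixed in advance, and strong selectivity produces
a positive set of rows [s 0 < s 1 < ...] such that [s (i+1)] is bad for the tail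
at [G (s i)] and avoids the exceptional sets met so far. Glue the sequences
[u(G (s i), s (i+1))] into a null sequence [z]. In row [s (i+1)], the new block
contributes more than [3 G (s i)], the earlier ones at most [G (s i)] because
[G] dominates the bounds [r], and the later ones at most [1] because [G] also
dominates a finite tail norm of that row. So the transform of [z] is unbounded
along a positive set, a contradiction. The finite tail norms used here come from
the same gluing performed inside a single row ([row_some_tail_finite]).

If all entries are bounded, the columns before [k0] have to be bounded in
operator norm on a set of the dual filter. This is a uniform boundedness
principle modulo the ideal, which follows from the necessity part applied to the
matrix of entries [2^-k T_n] ([ideal_uniform_boundedness]). *)

(** * Ideals and boundedness modulo an ideal *)

Lemma real_le_nat (R : realType) (r : R) : exists m : nat, r <= m%:R.
Proof.
exists (Num.bound `|r|); rewrite (le_trans (ler_norm _))// ltW//.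
exact: archi_boundP.
Qed.

Lemma ideal_bigcup (J : set (set nat)) (B : nat -> set nat) (N : nat) :
  set_ideal J -> (forall i, J (B i)) ->
  J [set m | exists2 i, (i < N)%N & B i m].
Proof.
move=> idJ JB; elim: N => [|N IH].
  apply: (ideal_sub idJ _ (ideal_fin idJ (finite_set0 nat))).
  by move=> m /= [].
apply: (ideal_sub idJ _ (ideal_setU idJ IH (JB N))) => m /= [i].
by rewrite ltnS leq_eqVlt => /orP[/eqP->|]; [right|left; exists i].
Qed.

(** Bounds are natural numbers because they enter the recursion that defines a
fast growing function on [nat]. *)
Definition ideal_bounded (R : realType) (J : set (set nat)) (y : nat -> R) :=
  exists r : nat, J [set n | r%:R <= y n].

Lemma ideal_limsup_lty (R : realType) (J : set (set nat)) (y : nat -> R) :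
  set_ideal J -> (ideal_limsup J y < +oo)%E <-> ideal_bounded J y.
Proof.
move=> idJ; split.
- move=> /ereal_inf_lt[[r||//] [_ Jr] _] //.
  have [m rm] := real_le_nat r.
  by exists m; apply: (ideal_sub idJ _ Jr) => n /=; rewrite lee_fin; apply: le_trans.
- move=> [r Jr]; apply: (@le_lt_trans _ _ (r%:R)%:E%E); last exact: ltry.
  by apply: ereal_inf_lbound; split.
Qed.

Lemma ideal_boundedD (R : realType) (J : set (set nat)) (y z : nat -> R) :
  set_ideal J -> ideal_bounded J y -> ideal_bounded J z ->
  ideal_bounded J (fun n => y n + z n).
Proof.
move=> idJ [r Jr] [s Js]; exists (r + s)%N.
apply: (ideal_sub idJ _ (ideal_setU idJ Jr Js)) => n /=; rewrite natrD => h.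
have [|yr] := leP r%:R (y n); first by left.
have [|zs] := leP s%:R (z n); first by right.
by have := ltrD yr zs; rewrite ltNge h.
Qed.

Lemma ideal_bounded_le (R : realType) (J : set (set nat)) (y z : nat -> R)
    (c : R) (J0 : set nat) :
  set_ideal J -> dual_filter J J0 -> ideal_bounded J z ->
  (forall n, J0 n -> y n <= z n + c) -> ideal_bounded J y.
Proof.
move=> idJ JJ0 [r Jr] yz; have [m cm] := real_le_nat c.
exists (r + m)%N; apply: (ideal_sub idJ _ (ideal_setU idJ Jr JJ0)) => n /=.
rewrite natrD => h; have [J0n|] := pselect (J0 n); last by right.
by left; have := yz n J0n; lra.
Qed.

(** * Group norms of tails *)

Section GroupNorms.
Context (R : realType) (X Y : completeNormedModType R).
Implicit Types (A : operator_matrix X Y) (x : nat -> X).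

Lemma big_fset_interval (V : nmodType) (F : {fset nat}) (a b : nat)
    (g : nat -> V) :
  (forall k, k \in F -> (a <= k < b)%N) ->
  \sum_(k <- F) g k = \sum_(a <= k < b) (if k \in F then g k else 0).
Proof.
move=> Fab; rewrite -big_mkcond -big_filter; apply: perm_big.
apply: uniq_perm; [exact: fset_uniq|exact/filter_uniq/iota_uniq|].
move=> k; rewrite mem_filter mem_index_iota.
by case kF: (k \in F) => //=; rewrite (Fab _ kF).
Qed.

Lemma tail_norm_antitone A n a c :
  (a <= c)%N -> (tail_norm A n c <= tail_norm A n a)%E.
Proof.
move=> ac; apply: le_ereal_sup => _ [F [x [Fc x1 ->]]].
by exists F, x; split=> // k /Fc /=; apply: leq_trans.
Qed.

Lemma group_norm_lty A n (E : set nat) :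
  (group_norm A n E < +oo)%E -> exists M : nat, (group_norm A n E <= M%:R%:E)%E.
Proof.
case: (group_norm A n E) => [r _|//|_]; last by exists 0%N; rewrite leNye.
by have [m rm] := real_le_nat r; exists m; rewrite lee_fin.
Qed.

(** Homogeneity carries the bound from the unit ball to vectors of size [e]. The
sum may start at any [c] beyond [a], so one tail norm serves both as a bound for
the whole tail and in the Cauchy criterion. *)
Lemma tail_norm_sum_le A n a c b x (M e : R) :
  (tail_norm A n a <= M%:E)%E -> (a <= c)%N -> 0 < e ->
  (forall k, (c <= k)%N -> `|x k| <= e) ->
  `|\sum_(c <= k < b) A n k (x k)| <= e * M.
Proof.
move=> AM ac e0 xe.
pose F := [fset k in index_iota c b]%fset.
pose w k := if (c <= k)%N then e^-1 *: x k else 0.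
have : (`|\sum_(k <- F) A n k (w k)|%:E <= M%:E)%E.
  apply: le_trans AM; apply: ereal_sup_ubound; exists F, w; split=> //.
  - by move=> k /=; rewrite !inE mem_index_iota => /andP[ck _]; apply: leq_trans ck.
  - move=> k; rewrite /w; case: ifPn => ck; last by rewrite normr0.
    by rewrite normrZ gtr0_norm ?invr_gt0// mulrC ler_pdivrMr// mul1r xe.
rewrite (@big_fset_interval _ _ c b); last first.
  by move=> k; rewrite !inE mem_index_iota.
have -> : \sum_(c <= k < b) (if k \in F then A n k (w k) else 0) =
    e^-1 *: \sum_(c <= k < b) A n k (x k).
  rewrite scaler_sumr; apply: eq_big_nat => k ckb.
  rewrite !inE mem_index_iota ckb /w; case/andP: ckb => -> _.
  by rewrite linearZ.
by rewrite lee_fin normrZ gtr0_norm ?invr_gt0// mulrC ler_pdivrMr// mulrC.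
Qed.

(** A witness for a large group norm lives on a finite set; extending it by zero
to an interval lets humps be handled as blocks of consecutive indices. *)
Lemma tail_norm_gt A n a (M : R) :
  (M%:E < tail_norm A n a)%E -> exists b x,
    [/\ (a < b)%N, forall k, `|x k| <= 1,
        forall k, ~~ (a <= k < b)%N -> x k = 0 &
        M < `|\sum_(a <= k < b) A n k (x k)|].
Proof.
move=> /ereal_sup_gt[_ [F [x [Fa x1 ->]]]]; rewrite lte_fin => MF.
pose b := (a + \max_(k <- F) k).+1.
have Fab k : k \in F -> (a <= k < b)%N.
  move=> kF; rewrite (Fa _ kF)/= /b ltnS (leq_trans _ (leq_addl _ _))//.
  by rewrite (big_rem k)//= leq_maxl.
exists b, (fun k => if k \in F then x k else 0); split.
- by rewrite /b ltnS leq_addr.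
- by move=> k; case: ifP => // _; rewrite normr0.
- by move=> k kab; case: ifP => // /Fab; rewrite (negbTE kab).
- rewrite (@big_fset_interval _ _ a b _ Fab) in MF.
  rewrite (lt_le_trans MF)// le_eqVlt; apply/orP; left; apply/eqP.
  congr `|_|; apply: eq_bigr => k _.
  by case: ifP => // _; rewrite linear0.
Qed.

End GroupNorms.

(** * Row series and sufficiency of the conditions *)

Section Rows.
Context (R : realType) (X Y : completeNormedModType R).
Implicit Types (A : operator_matrix X Y) (x : nat -> X).

Lemma matrix_apply_tail_le A n a x (M e : R) :
  cvgn (row_series A n x) -> (tail_norm A n a <= M%:E)%E -> 0 < e ->
  (forall k, (a <= k)%N -> `|x k| <= e) ->
  `|matrix_apply A x n - row_series A n x a| <= e * M.
Proof.
move=> cx AM e0 xe.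
have cvx : `|row_series A n x N - row_series A n x a| @[N --> \oo]
    --> `|matrix_apply A x n - row_series A n x a|.
  by apply: cvg_norm; apply: cvgB; [exact: cx|exact: cvg_cst].
rewrite -(cvg_lim _ cvx)//; apply: limr_le; first by apply/cvg_ex; eexists; exact: cvx.
exists a => // N /= aN.
by rewrite /row_series sub_series_geq// (tail_norm_sum_le _ AM).
Qed.

Lemma matrix_apply_finite_support A n b x :
  (forall k, (b <= k)%N -> x k = 0) ->
  matrix_apply A x n = row_series A n x b.
Proof.
move=> x0; apply: lim_near_cst => //.
exists b => // N /= bN; apply/eqP; rewrite -subr_eq0 /row_series sub_series_geq//.
rewrite big_nat big1// => k /andP[bk _].
by rewrite x0// linear0.
Qed.

Lemma finite_support_cvg (V : completeNormedModType R) b (x : nat -> V) :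
  (forall k, (b <= k)%N -> x k = 0) -> convergent_seqs V x.
Proof.
by move=> x0; apply: (@is_cvg_near_cst _ _ 0); exists b.
Qed.

Lemma null_row_cvg A n a x :
  (tail_norm A n a < +oo)%E -> x k @[k --> \oo] --> (0 : X) ->
  cvgn (row_series A n x).
Proof.
move=> /group_norm_lty[M AM] x0.
apply/cauchy_cvgP/cauchy_seriesP => e e0.
have d0 : 0 < e / (M.+1)%:R by rewrite divr_gt0.
have /cvgr0Pnorm_le/(_ _ d0)[N _ xN] := x0.
exists ([set m | (maxn a N <= m)%N], setT).
  by split=> //=; [exists (maxn a N)|exact: filterT].
move=> [m b] /= [mN _].
apply: (@le_lt_trans _ _ (e / (M.+1)%:R * M%:R)).
  apply: (@tail_norm_sum_le _ _ _ _ _ a) => //.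
  - by apply: leq_trans mN; exact: leq_maxl.
  - move=> k mk; apply: xN => /=; apply: leq_trans mk; apply: leq_trans mN.
    exact: leq_maxr.
by rewrite mulrAC ltr_pdivrMr// ltr_pM2l// ltr_nat.
Qed.

(** A convergent sequence is a constant one plus a null one: strong convergence of
the row sums handles the former, finiteness of some tail the latter. *)
Lemma convergent_row_cvg A n a x :
  row_convergence A -> (tail_norm A n a < +oo)%E -> cvgn x ->
  cvgn (row_series A n x).
Proof.
move=> rA Aa cx; pose l := limn x.
have -> : row_series A n x =
    row_series A n (fun=> l) + row_series A n (fun k => x k - l).
  apply/funext => N; rewrite fctE /row_series /series /= -big_split /=.
  by apply: eq_bigr => k _; rewrite -linearD addrC subrK.
apply: is_cvgD; first exact: rA.
apply: (@null_row_cvg _ _ a) => //.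
by rewrite -(subrr l); apply: cvgB; [exact: cx|exact: cvg_cst].
Qed.

Lemma column_condition_ideal_bounded A (J : set (set nat)) k0 x :
  set_ideal J -> column_condition A J k0 ->
  ideal_bounded J (fun n => `|row_series A n x k0|).
Proof.
move=> idJ; elim: k0 => [|k IH] cA.
  exists 1%N; apply: (ideal_sub idJ _ (ideal_fin idJ (finite_set0 nat))).
  by move=> n; rewrite /= /row_series /series /= big_geq// normr0 ler10.
have JT : dual_filter J setT.
  by rewrite /dual_filter /= setCT; exact: ideal_fin.
have Jk : ideal_bounded J (fun n => `|A n k (x k)|).
  by apply/ideal_limsup_lty => //; apply: cA.
apply: (@ideal_bounded_le _ _ _ _ 0 _ idJ JT (ideal_boundedD idJ (IH _) Jk)).
  by move=> y j jk; apply: cA; exact: leqW.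
by move=> n _; rewrite addr0 /row_series /series /= big_nat_recr//= ler_normD.
Qed.

Lemma matrix_class_of_conditions A (J : set (set nat)) k0 :
  set_ideal J -> tail_condition A J k0 -> column_condition A J k0 ->
  row_convergence A ->
  matrix_class (convergent_seqs X) (ideal_bounded_seqs Y J) A.
Proof.
move=> idJ [J0 [JJ0 supJ0 outJ0]] cA rA x cx.
have tJ0 n : J0 n -> (tail_norm A n k0 <= ereal_sup [set tail_norm A n k0 | n in J0])%E.
  by move=> J0n; apply: ereal_sup_ubound; exists n.
have rowcvg n : cvgn (row_series A n x).
  have [J0n|/outJ0[a Aa]] := pselect (J0 n).
    by apply: (@convergent_row_cvg _ _ k0) => //; exact: le_lt_trans (tJ0 n J0n) supJ0.
  exact: (@convergent_row_cvg _ _ a).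
split=> //; apply/ideal_limsup_lty => //.
have [M AM] : exists M : nat, forall n, J0 n -> (tail_norm A n k0 <= M%:R%:E)%E.
  have : exists M : nat, (ereal_sup [set tail_norm A n k0 | n in J0] <= M%:R%:E)%E.
    case: ereal_sup supJ0 => [r _|//|_]; last by exists 0%N; rewrite leNye.
    by have [m rm] := real_le_nat r; exists m; rewrite lee_fin.
  by move=> [M supM]; exists M => n /tJ0 /le_trans; apply.
have [C C0 xC] := pinfty_ex_gt0 (cvg_seq_bounded cx).
apply: (@ideal_bounded_le _ _ _ _ (C * M%:R) _ idJ JJ0
  (column_condition_ideal_bounded x idJ cA)) => n J0n.
have := @matrix_apply_tail_le A n k0 x _ _ (rowcvg n) (AM n J0n) C0 (fun k _ => xC k I).
rewrite -[matrix_apply A x n in X in _ -> X](subrK (row_series A n x k0) (matrix_apply A x n)) => h.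
by rewrite (le_trans (ler_normD _ _))// [leRHS]addrC lerD.
Qed.

End Rows.

(** * Blocks and their gluing *)

Section GlidingHump.
Context (R : realType) (X Y : completeNormedModType R).
Implicit Types (A : operator_matrix X Y) (x : nat -> X).

(** The intervals between consecutive values of [p] are disjoint, so at most one
[w i] is relevant at each index. Since the size of [w i] is controlled by its
starting point, the glued sequence is null. *)
Lemma glue_blocks (p : nat -> nat) (w : nat -> nat -> X) :
  {homo p : i j / (i < j)%N} ->
  (forall i k, `|w i k| <= (p i).+1%:R^-1) ->
  exists z : nat -> X,
    [/\ forall i k, (p i <= k < p i.+1)%N -> z k = w i k,
        forall k, (k < p 0)%N -> z k = 0,
        forall i k, (p i <= k)%N -> `|z k| <= (p i).+1%:R^-1 &
        z k @[k --> \oo] --> (0 : X)].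
Proof.
move=> pS wp.
have ple : {homo p : i j / (i <= j)%N}.
  by move=> i j; rewrite leq_eqVlt => /orP[/eqP->//|/pS/ltnW].
have pge i : (i <= p i)%N.
  by elim: i => // i IH; apply: (leq_ltn_trans IH); exact: pS.
have in_block_lt i j k : (p i <= k)%N -> (p j <= k < p j.+1)%N -> (i <= j)%N.
  move=> pik /andP[_ kpj]; rewrite leqNgt; apply/negP => /ple pji.
  by move: (leq_ltn_trans (leq_trans pji pik) kpj); rewrite ltnn.
have /choice[z zP] k : exists v : X,
    (forall i, (p i <= k < p i.+1)%N -> v = w i k) /\
    ((forall i, ~~ (p i <= k < p i.+1)%N) -> v = 0).
  have [[i ik]|nk] := pselect (exists i, (p i <= k < p i.+1)%N); last first.
    by exists 0; split=> // i ik; case: nk; exists i.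
  exists (w i k); split=> [j jk|/(_ i)]; last by rewrite ik.
  suff -> : i = j by [].
  apply/eqP; rewrite eqn_leq (in_block_lt _ _ k)//=; last by case/andP: ik.
  by rewrite (in_block_lt _ _ k)//; case/andP: jk.
have zle i k : (p i <= k)%N -> `|z k| <= (p i).+1%:R^-1.
  move=> pik; have [[j jk]|nk] := pselect (exists j, (p j <= k < p j.+1)%N).
    rewrite ((zP k).1 j jk) (le_trans (wp j k))// lef_pV2 ?posrE//.
    by rewrite ler_nat ltnS ple// (in_block_lt _ _ k).
  rewrite ((zP k).2 _) ?normr0// => j; apply/negP => jk.
  by apply: nk; exists j.
exists z; split=> //.
- by move=> i k /((zP k).1 i).
- move=> k kp0; apply: (zP k).2 => i; rewrite negb_and -ltnNge.
  by rewrite (leq_trans kp0)// ple.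
- apply/cvgr0Pnorm_le => e e0.
  have [i ei] := real_le_nat e^-1.
  exists (p i) => // k /zle /le_trans; apply.
  rewrite -[e]invrK lef_pV2 ?posrE ?invr_gt0// (le_trans ei)// ler_nat.
  exact: leq_trans (pge i) (leqnSn _).
Qed.

Definition block_sum A n a b x : Y := \sum_(a <= k < b) A n k (x k).

Lemma row_series_blocks A n (p b : nat -> nat) (w : nat -> nat -> X)
    (z : nat -> X) i :
  (forall i k, (p i <= k < p i.+1)%N -> z k = w i k) ->
  (forall k, (k < p 0)%N -> z k = 0) ->
  (forall i, (p i <= b i <= p i.+1)%N) ->
  (forall i k, ~~ (p i <= k < b i)%N -> w i k = 0) ->
  row_series A n z (p i) = \sum_(j < i) block_sum A n (p j) (b j) (w j).
Proof.
move=> zw z0 pb w0; elim: i => [|i IH].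
  rewrite big_ord0 /row_series /series /= big_nat big1// => k /= kp.
  by rewrite z0// linear0.
have /andP[pbi bpi] := pb i.
rewrite big_ord_recr/= -IH; apply/eqP; rewrite addrC -subr_eq /row_series.
rewrite sub_series_geq; last exact: leq_trans bpi.
rewrite (@big_cat_nat _ _ _ (b i))//= [X in _ + X]big_nat [X in _ + X]big1 ?addr0.
  apply/eqP/eq_big_nat => k /andP[pk kb].
  by rewrite (zw i)// pk (leq_trans kb).
move=> k /andP[bk kp]; rewrite (zw i) ?kp ?(leq_trans pbi)// w0 ?linear0//.
by rewrite negb_and -!ltnNge orbC ltnS bk.
Qed.

(** The threshold is calibrated so that a witness shrunk to size [1/(a+1)], small
enough for gluing into a null sequence, still has an image larger than [3a].
When the tail norm is below the threshold the zero sequence serves, which makes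
the choice of a block total in [a] and [n]. *)
Lemma scaled_block A n a : exists b x,
  [/\ (a < b)%N, forall k, `|x k| <= a.+1%:R^-1,
      forall k, ~~ (a <= k < b)%N -> x k = 0 &
      ((3 * a * a.+1)%:R%:E < tail_norm A n a)%E ->
        (3 * a)%:R < `|block_sum A n a b x|].
Proof.
have [|big] := pselect ((3 * a * a.+1)%:R%:E < tail_norm A n a)%E; last first.
  exists a.+1, (fun=> 0); split=> //; by move=> k; rewrite normr0 invr_ge0.
move=> /tail_norm_gt[b [x [ab x1 x0 xb]]].
exists b, (fun k => a.+1%:R^-1 *: x k); split=> //.
- by move=> k; rewrite normrZ gtr0_norm ?invr_gt0// ler_piMr// invr_ge0.
- by move=> k /x0 ->; rewrite scaler0.
- move=> _; have -> : block_sum A n a b (fun k => a.+1%:R^-1 *: x k) =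
      a.+1%:R^-1 *: \sum_(a <= k < b) A n k (x k).
    by rewrite scaler_sumr; apply: eq_bigr => k _; rewrite linearZ.
  by rewrite normrZ gtr0_norm ?invr_gt0// mulrC ltr_pdivlMr// -natrM.
Qed.

(** If every tail of the row had infinite norm, consecutive blocks with images of
norm at least [3] could be glued into a null sequence whose row series is not
Cauchy. *)
Lemma row_some_tail_finite A n :
  (forall x, x k @[k --> \oo] --> (0 : X) -> cvgn (row_series A n x)) ->
  exists a, (tail_norm A n a < +oo)%E.
Proof.
move=> cA; apply: contrapT => tailA.
have inftyA a : tail_norm A n a = +oo%E.
  by apply/eqP; rewrite -leye_eq leNgt; apply/negP => Aa; apply: tailA; exists a.
have /choice[bx bxP] a : exists bx : nat * (nat -> X),
    [/\ (a < bx.1)%N, forall k, `|bx.2 k| <= a.+1%:R^-1,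
      forall k, ~~ (a <= k < bx.1)%N -> bx.2 k = 0 &
      (3 * a)%:R < `|block_sum A n a bx.1 bx.2|].
  have [b [x [ab x1 x0 xb]]] := scaled_block A n a.
  by exists (b, x); split=> //; apply: xb; rewrite inftyA ltry.
(* Starting at 1 rather than 0 keeps the lower bound [3 * p i] away from 0. *)
pose p i := iter i (fun a => (bx a).1) 1%N.
have pS i : (p i < p i.+1)%N by have [] := bxP (p i).
have ple : {homo p : i j / (i < j)%N}.
  by apply: homo_ltn => //; exact: ltn_trans.
have p1 i : (0 < p i)%N by case: i => // i; exact: leq_ltn_trans (pS i).
have [|z [zw z0 _ zcvg]] := @glue_blocks p (fun i => (bx (p i)).2) ple.
  by move=> i k; have [] := bxP (p i).
have /cvg_cauchy/cauchy_seriesP/(_ 1 ltr01) := cA z zcvg.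
move=> [[P Q] /= [[N1 _ N1P] [N2 _ N2P]] PQ].
pose i := maxn N1 N2.
have pge j : (j <= p j)%N.
  by elim: j => // j IH; apply: (leq_ltn_trans IH); exact: pS.
have /= := PQ (p i, p i.+1); rewrite ltNge => /(_ _)/negP; apply.
  split; [apply: N1P|apply: N2P] => /=.
    by apply: leq_trans (pge i); exact: leq_maxl.
  by apply: leq_trans (ltnW (pS i)); apply: leq_trans (pge i); exact: leq_maxr.
have -> : \sum_(p i <= k < p i.+1) A n k (z k) =
    block_sum A n (p i) (bx (p i)).1 (bx (p i)).2.
  by apply: eq_big_nat => k /zw ->.
have [_ _ _ /ltW] := bxP (p i); apply: le_trans.
by rewrite ler1n muln_gt0/=.
Qed.

End GlidingHump.

(** * The gliding hump along a selective ideal *)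

(** The value at [m] dominates finitely many quantities that depend only on
earlier values of [G] and on indices up to [m]. Thus the growth needed by the
gliding hump can be prescribed before the rows are selected. *)
Lemma fast_growing (q : nat -> nat -> nat -> nat) (d : nat -> nat) :
  exists G : nat -> nat,
    [/\ {homo G : k m / (k < m)%N}, forall m, (d m <= G m)%N &
        forall k m n, (k < m)%N -> (n <= m)%N -> (q m (G k) n <= G m)%N].
Proof.
pose next m c := (c.+1 + d m + \sum_(a < c.+1) \sum_(n < m.+1) q m a n)%N.
pose G := fix G m := if m is m'.+1 then next m (G m') else d 0%N.
have GS m : G m.+1 = next m.+1 (G m) by [].
have Glt : {homo G : k m / (k < m)%N}.
  apply: homo_ltn; first exact: ltn_trans.
  by move=> m; rewrite GS /next -addnA leq_addr.
exists G; split=> //.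
  by case=> // m; rewrite GS /next addnAC leq_addl.
move=> k [//|m] n; rewrite ltnS => km nm.
rewrite GS /next (leq_trans _ (leq_addl _ _))//.
have Gk : (G k < (G m).+1)%N.
  by rewrite ltnS; move: km; rewrite leq_eqVlt => /orP[/eqP->//|/Glt/ltnW].
have nm' : (n < m.+2)%N by [].
rewrite (bigD1 (Ordinal Gk))//= (bigD1 (Ordinal nm'))//= -!addnA.
exact: leq_addr.
Qed.

Section Necessity.
Context (R : realType) (X Y : completeNormedModType R).
Implicit Types (A : operator_matrix X Y) (x : nat -> X) (J : set (set nat)).

(** Extended by zero, a block is a convergent sequence, so membership in the class
bounds its transform at once. *)
Lemma finite_support_ideal_bounded A J a b x :
  set_ideal J ->
  matrix_class (convergent_seqs X) (ideal_bounded_seqs Y J) A ->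
  (forall k, ~~ (a <= k < b)%N -> x k = 0) ->
  ideal_bounded J (fun n => `|block_sum A n a b x|).
Proof.
move=> idJ clA x0.
have xb k : (b <= k)%N -> x k = 0.
  by move=> bk; apply: x0; rewrite negb_and orbC -leqNgt bk.
have [_ /(ideal_limsup_lty _ idJ)[r Jr]] := clA x (finite_support_cvg xb).
exists r; apply: (ideal_sub idJ _ Jr) => n /=.
rewrite (matrix_apply_finite_support _ _ xb) /row_series /series /=.
have [ab|ba] := leqP a b; last first.
  by rewrite [block_sum _ _ _ _ _]big_geq ?(ltnW ba)// normr0 => /le_trans; apply.
rewrite (@big_cat_nat _ _ _ a)//= [X in X + _]big_nat [X in X + _]big1 ?add0r//.
by move=> k /andP[_ ka]; rewrite x0 ?linear0// negb_and -ltnNge ka.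
Qed.

(** The gliding hump. Failure for every [a] would supply positive sets from which
selectivity extracts rows whose humps do not interfere. *)
Lemma matrix_class_tail_ideal A J :
  set_ideal J -> strongly_selective J ->
  matrix_class (convergent_seqs X) (ideal_bounded_seqs Y J) A ->
  exists a, J [set n | ((3 * a * a.+1)%:R%:E < tail_norm A n a)%E].
Proof.
move=> idJ selJ clA; apply: contrapT => tailA.
have bigA a : ~ J [set n | ((3 * a * a.+1)%:R%:E < tail_norm A n a)%E].
  by move=> Ja; apply: tailA; exists a.
have /choice[fM fMP] n : exists fM : nat * nat,
    (tail_norm A n fM.1 <= fM.2%:R%:E)%E.
  have [x x0|a /group_norm_lty[M AM]] := @row_some_tail_finite _ _ _ A n.
    by have [] := clA x; first by apply/cvg_ex; exists 0.
  by exists (a, M).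
have /choice[bx bxP] (an : nat * nat) : exists bx : nat * (nat -> X),
    [/\ (an.1 < bx.1)%N, forall k, `|bx.2 k| <= an.1.+1%:R^-1,
      forall k, ~~ (an.1 <= k < bx.1)%N -> bx.2 k = 0 &
      ((3 * an.1 * an.1.+1)%:R%:E < tail_norm A an.2 an.1)%E ->
        (3 * an.1)%:R < `|block_sum A an.2 an.1 bx.1 bx.2|].
  by have [b [x xP]] := scaled_block A an.2 an.1; exists (b, x).
pose b a n := (bx (a, n)).1; pose u a n := (bx (a, n)).2.
pose V a n m := block_sum A m a (b a n) (u a n).
have /choice[r rP] (an : nat * nat) : exists r : nat,
    J [set m | r%:R <= `|V an.1 an.2 m|].
  apply: (finite_support_ideal_bounded idJ clA).
  by have [] := bxP (an.1, an.2).
(* The factor [m] lets [G] dominate a sum of up to [m] bounds [r]. *)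
have [G [Glt dG qG]] := fast_growing
  (fun m a n => b a n + m * r (a, n))%N (fun m => (fM m).1 + (fM m).2 + m.+1)%N.
have Gle : {homo G : i j / (i <= j)%N}.
  by move=> i j; rewrite leq_eqVlt => /orP[/eqP->//|/Glt/ltnW].
pose B k := [set m | exists2 a, (a < (G k).+1)%N &
  exists2 n, (n < k.+1)%N & (r (a, n))%:R <= `|V a n m|].
have JB k : J (B k).
  by do 2!apply: ideal_bigcup => // ?; exact: (rP (_, _)).
(* Rows with a large tail that avoid all exceptional sets of blocks met so far:
   removing the latter, a set of the ideal, keeps the set positive. *)
pose S k := [set m | ((3 * G k * (G k).+1)%:R%:E < tail_norm A m (G k))%E] `\` B k.
have [||s [slt sJ sS]] := selJ S.
- move=> k JSk; apply: (bigA (G k)).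
  apply: (ideal_sub idJ _ (ideal_setU idJ JSk (JB k))) => m /= Am.
  by have [Bm|nBm] := pselect (B k m); [right|left].
- move=> k m [/= Am nBm]; have GG := Gle _ _ (leqnSn k); split=> /=.
    apply: le_lt_trans (lt_le_trans Am (tail_norm_antitone _ _ GG)).
    by rewrite lee_fin ler_nat leq_mul// leq_mul.
  apply: contra_not nBm => -[a aG [n nk Vr]].
  by exists a; [exact: leq_trans aG _|exists n => //; exact: ltnW].
have sge i : (i <= s i)%N.
  by elim: i => // i IH; apply: (leq_ltn_trans IH); exact: slt.
have sle : {homo s : i j / (i <= j)%N}.
  by move=> i j; rewrite leq_eqVlt => /orP[/eqP->//|/slt/ltnW].
pose p i := G (s i); pose w i := u (p i) (s i.+1); pose e i := b (p i) (s i.+1).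
have plt : {homo p : i j / (i < j)%N} by move=> i j /slt /Glt.
have pge i : (i < p i)%N.
  rewrite (leq_ltn_trans (sge i))// (leq_trans _ (dG (s i)))//.
  exact: leq_addl.
have pe i : (p i <= e i <= p i.+1)%N.
  have [/ltnW/= pei _ _ _] := bxP (p i, s i.+1); rewrite [(_ <= e i)%N]pei /=.
  apply: leq_trans (qG (s i) (s i.+1) (s i.+1) _ _) => //.
    exact: leq_addr.
  exact: slt.
have [|z [zw z0 zle zcvg]] := glue_blocks (w := w) plt.
  by move=> i k; have [_ w1 _ _] := bxP (p i, s i.+1); exact: w1.
have [zrow zJ] : (forall n, cvgn (row_series A n z)) /\
    ideal_bounded J (fun n => `|matrix_apply A z n|).
  have [|zrow /(ideal_limsup_lty _ idJ) zJ] := clA z; last by split.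
  by apply/cvg_ex; exists 0.
have rowz m i : row_series A m z (p i) = \sum_(j < i) V (p j) (s j.+1) m.
  apply: (@row_series_blocks _ _ _ A m p e w z) => // j k.
  by have [_ _ w0 _] := bxP (p j, s j.+1); exact: w0.
have large i : i%:R <= `|matrix_apply A z (s i.+1)|.
  set m := s i.+1; have [/= Am nBm] := sS i; rewrite -/m in Am nBm.
  have hump : (3 * p i)%:R < `|V (p i) m m|.
    by have [_ _ _ h] := bxP (p i, m); exact: h.
  have past : `|\sum_(j < i) V (p j) (s j.+1) m| <= (p i)%:R.
    have Vj (j : 'I_i) : `|V (p j) (s j.+1) m| <= (r (p j, s j.+1))%:R.
      rewrite leNgt; apply/negP => /ltW Vr; apply: nBm.
      exists (p j); first by rewrite ltnS; exact/Gle/sle/ltnW.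
      by exists (s j.+1) => //; rewrite ltnS; exact: sle.
    apply: (le_trans (ler_norm_sum _ _ _)).
    apply: (le_trans (ler_sum _ (fun j _ => Vj j))).
    rewrite -natr_sum ler_nat.
    (* There are [i] terms and [i <= s i], the factor built into [G]. *)
    case: (posnP i) => [i0|i0].
      by rewrite big1// => -[j] /=; rewrite i0.
    rewrite -(leq_pmul2l i0).
    apply: (@leq_trans (\sum_(j < i) p i)); last by rewrite sum_nat_const card_ord.
    rewrite big_distrr/=; apply: leq_sum => j _.
    apply: leq_trans (qG (s j) (s i) (s j.+1) _ _); last 2 first.
    - exact: slt.
    - exact: sle.
    by rewrite (leq_trans _ (leq_addl _ _))// leq_mul2r sge orbT.
  have future : `|matrix_apply A z m - row_series A m z (p i.+1)| <= 1.
    have tm : (tail_norm A m (p i.+1) <= (p i.+1).+1%:R%:E)%E.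
      have Gm := dG m.
      apply: (le_trans (tail_norm_antitone A m (_ : ((fM m).1 <= p i.+1)%N))).
        by apply: leq_trans Gm; rewrite -addnA leq_addr.
      apply: (le_trans (fMP m)); rewrite lee_fin ler_nat (leq_trans _ (leqnSn _))//.
      by apply: leq_trans Gm; rewrite addnAC leq_addl.
    have := matrix_apply_tail_le (zrow m) tm _ (zle i.+1).
    by rewrite mulVf ?pnatr_eq0//; apply; rewrite invr_gt0.
  rewrite rowz big_ord_recr /= -/m in future.
  set P := \sum_(j < i) _ in past future.
  have : `|V (p i) m m| <= `|matrix_apply A z m| +
      `|matrix_apply A z m - (P + V (p i) m m)| + `|P|.
    rewrite {1}(_ : V (p i) m m = matrix_apply A z m -
      (matrix_apply A z m - (P + V (p i) m m)) - P); last first.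
      by rewrite subKr addrC addKr.
    by rewrite (le_trans (ler_normB _ _))// lerD2r ler_normB.
  have ip : (i.+1%:R : R) <= (p i)%:R by rewrite ler_nat.
  by move: hump past future ip (ler0n R i); rewrite natrM -[i.+1%:R]natr1; lra.
(* The transform of [z] is at most [c] only for finitely many selected rows. *)
have [c Jc] := zJ; apply: sJ.
apply: (ideal_sub idJ _ (ideal_setU idJ Jc
  (ideal_fin idJ (finite_image s (finite_II c.+1))))) => _ [i _ <-].
have [ic|] := ltnP i c.+1; first by right; exists i.
case: i => // i ci; left => /=; apply: le_trans (large i).
by rewrite ler_nat.
Qed.

End Necessity.

(** * Necessity of the conditions and bounded entries *)

Section Characterization.
Context (R : realType) (X Y : completeNormedModType R).
Implicit Types (A : operator_matrix X Y) (x : nat -> X) (J : set (set nat)).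

Lemma matrix_class_row_tails A J :
  matrix_class (convergent_seqs X) (ideal_bounded_seqs Y J) A ->
  forall n, exists a, (tail_norm A n a < +oo)%E.
Proof.
move=> clA n; apply: row_some_tail_finite => x x0.
by have [] := clA x; first by apply/cvg_ex; exists 0.
Qed.

Lemma matrix_class_tail_condition A J (a M : nat) :
  matrix_class (convergent_seqs X) (ideal_bounded_seqs Y J) A ->
  J [set n | (M%:R%:E < tail_norm A n a)%E] -> tail_condition A J a.
Proof.
move=> clA JA; exists (~` [set n | (M%:R%:E < tail_norm A n a)%E]); split.
- by rewrite /dual_filter /= setCK.
- apply: (@le_lt_trans _ _ (M%:R%:E)%E); last exact: ltry.
  by apply: ge_ereal_sup => _ [n /= /negP + <-]; rewrite -leNgt.
- by move=> n _; exact: matrix_class_row_tails clA n.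
Qed.

Lemma matrix_class_column_condition A J k0 :
  set_ideal J ->
  matrix_class (convergent_seqs X) (ideal_bounded_seqs Y J) A ->
  column_condition A J k0.
Proof.
move=> idJ clA x k _; apply/ideal_limsup_lty => //.
have [|r Jr] := @finite_support_ideal_bounded _ _ _ A J k k.+1
    (fun j => if j == k then x else 0) idJ clA.
  by move=> j; case: eqP => // ->; rewrite leqnn ltnSn.
exists r; apply: (ideal_sub idJ _ Jr) => n /=.
by rewrite /block_sum big_nat1 eqxx.
Qed.

Lemma matrix_class_row_convergence A J :
  matrix_class (convergent_seqs X) (ideal_bounded_seqs Y J) A ->
  row_convergence A.
Proof. by move=> clA n x; have [] := clA (fun=> x); first exact: is_cvg_cst. Qed.

Lemma bounded_fun_norm_continuous (T : {linear X -> Y}) :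
  bounded_fun_norm T -> continuous T.
Proof.
move=> bT; apply/linear_bounded_continuous/ex_bound.
have [M TM] := bT 1; exists M; near=> x; apply: TM.
by near: x; apply: nbhs0_le.
Unshelve. all: by end_near. Qed.

(** The matrix with entries [2^-k T_n] is in the class: for convergent [x] the
series of [2^-k x_k] converges to some [v] by completeness, and row [n] sends
[x] to [T_n v] by continuity. A bound for one of its tails bounds [2^-a T_n],
hence [T_n]. *)
Lemma ideal_uniform_boundedness (T : nat -> {linear X -> Y}) J :
  set_ideal J -> strongly_selective J -> (forall n, bounded_fun_norm (T n)) ->
  (forall x : X, ideal_bounded J (fun n => `|T n x|)) ->
  exists M : nat, J [set n | ~ forall x : X, `|x| <= 1 -> `|T n x| <= M%:R].
Proof.
move=> idJ selJ bT pT.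
pose A : operator_matrix X Y := fun n k => (2^-1 ^+ k : R) \*: T n.
have clA : matrix_class (convergent_seqs X) (ideal_bounded_seqs Y J) A.
  move=> x cx.
  pose v k := (2^-1 ^+ k : R) *: x k.
  have cv : cvgn (series v).
    have [C C0 xC] := pinfty_ex_gt0 (cvg_seq_bounded cx).
    apply: normed_cvg; apply: (@series_le_cvg _ _ (geometric C 2^-1)).
    - by move=> k; rewrite normr_ge0.
    - by move=> k; rewrite mulr_ge0 ?exprn_ge0 ?ltW.
    - move=> k; rewrite /v /= normrZ ger0_norm ?exprn_ge0// mulrC.
      by rewrite ler_wpM2r ?exprn_ge0//; exact: xC.
    - by apply: is_cvg_geometric_series; rewrite ger0_norm// invf_lt1 ?ltr1n.
  have rowE n : row_series A n x = T n \o series v.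
    apply/funext => N; rewrite /row_series /series /= linear_sum.
    by apply: eq_bigr => k _; rewrite /A /v linearZ.
  have rowc n : row_series A n x N @[N --> \oo] --> T n (limn (series v)).
    rewrite rowE; apply: continuous_cvg; last exact: cv.
    exact: bounded_fun_norm_continuous.
  split; first by move=> n; apply/cvg_ex; eexists; exact: rowc.
  apply/ideal_limsup_lty => //.
  have [r Jr] := pT (limn (series v)); exists r.
  apply: (ideal_sub idJ _ Jr) => n /=.
  by rewrite /matrix_apply (cvg_lim _ (rowc n)).
have [a Ja] := matrix_class_tail_ideal idJ selJ clA.
exists (2 ^ a * (3 * a * a.+1))%N; apply: (ideal_sub idJ _ Ja) => n /=.
apply: contra_notT; rewrite -leNgt => An x x1.
have := @tail_norm_sum_le _ _ _ A n a a a.+1 (fun=> x) _ 1 An (leqnn a) ltr01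
  (fun _ _ => x1).
rewrite big_nat1 /A /= normrZ ger0_norm ?exprn_ge0// mul1r exprVn.
by rewrite mulrC ler_pdivrMr ?exprn_gt0// [(2 ^ a * _)%:R]natrM natrX mulrC.
Qed.

Lemma tail_norm0_le A n k0 (M : R) (m : nat -> R) :
  (tail_norm A n k0 <= M%:E)%E ->
  (forall k, (k < k0)%N -> forall x : X, `|x| <= 1 -> `|A n k x| <= m k) ->
  (tail_norm A n 0 <= (\sum_(k < k0) m k + M)%:E)%E.
Proof.
move=> AM Am; rewrite leNgt; apply/negP => /tail_norm_gt[b [x [_ x1 x0]]].
apply/negP; rewrite -leNgt.
have -> : \sum_(0 <= k < b) A n k (x k) = \sum_(0 <= k < k0 + b) A n k (x k).
  rewrite [RHS](@big_cat_nat _ _ _ b)// ?leq_addl//= [X in _ + X]big_nat.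
  rewrite [X in _ + X]big1 ?addr0// => k /andP[bk _].
  by rewrite x0 ?linear0// -leqNgt.
rewrite (@big_cat_nat _ _ _ k0)// ?leq_addr//= (le_trans (ler_normD _ _))//.
rewrite lerD//.
  rewrite big_mkord (le_trans (ler_norm_sum _ _ _))// ler_sum// => k _.
  exact: Am.
by rewrite -[M]mul1r (tail_norm_sum_le _ AM).
Qed.

Lemma matrix_class_tail_condition0 A J :
  set_ideal J -> strongly_selective J ->
  (forall n k, bounded_fun_norm (A n k)) ->
  matrix_class (convergent_seqs X) (ideal_bounded_seqs Y J) A ->
  tail_condition A J 0.
Proof.
move=> idJ selJ bA clA.
have [a Ja] := matrix_class_tail_ideal idJ selJ clA.
have /choice[m mP] k : exists M : nat,
    J [set n | ~ forall x : X, `|x| <= 1 -> `|A n k x| <= M%:R].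
  apply: ideal_uniform_boundedness => // x.
  apply/(ideal_limsup_lty _ idJ).
  exact: (matrix_class_column_condition (k0 := k.+1) idJ clA).
apply: (@matrix_class_tail_condition _ _ 0 (\sum_(k < a) m k + 3 * a * a.+1)) => //.
apply: (ideal_sub idJ _ (ideal_setU idJ Ja (ideal_bigcup a idJ mP))) => n /=.
rewrite ltNge => /negP big0; apply: contrapT => /not_orP[/negP].
rewrite -leNgt => Aa Am; apply: big0; rewrite natrD natr_sum.
apply: (@tail_norm0_le A n a _ (fun k => (m k)%:R)) => // k ka x x1.
by apply: contrapT => nA; apply: Am; exists k => // /(_ x x1).
Qed.

End Characterization.

Theorem theorem3p10 (R : realType) (X Y : completeNormedModType R)
    (A : operator_matrix X Y) (J : set (set nat))
    (idealJ : set_ideal J) (selJ : strongly_selective J) :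
  (matrix_class (convergent_seqs X) (ideal_bounded_seqs Y J) A <->
     exists k0 : nat, [/\ tail_condition A J k0,
          column_condition A J k0 & row_convergence A]) /\
  ((forall n k : nat, bounded_fun_norm (A n k)) ->
   (matrix_class (convergent_seqs X) (ideal_bounded_seqs Y J) A <->
      [/\ tail_condition A J 0,
         column_condition A J 0 & row_convergence A])).
Proof.
split=> [|bA]; split=> [clA|].
- have [k0 Jk0] := matrix_class_tail_ideal idealJ selJ clA.
  exists k0; split; first exact: matrix_class_tail_condition clA Jk0.
    exact: matrix_class_column_condition clA.
  exact: matrix_class_row_convergence clA.
- by move=> [k0 [tA cA rA]]; exact: matrix_class_of_conditions tA cA rA.
- split; first exact: matrix_class_tail_condition0 clA.
    exact: matrix_class_column_condition clA.
  exact: matrix_class_row_convergence clA.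
- by move=> [tA cA rA]; exact: matrix_class_of_conditions tA cA rA.
Qed.
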